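(* Let $\mu,\nu\in\mathbb{R}$ be such that neither $\mu+\nu$ nor $\mu-\nu$ is a negative odd integer, and put $M=(\mu+5)^2-\nu^2$ and $N=(\mu+3)^2-\nu^2$. Suppose that $$\mu>-5+\left(\tfrac32+\nu^2\right)^{1/2},\qquad \frac{4M}{N}<2M-3,$$ and $$\mu(1+2\sin(1))-\frac14 e(e-1)\left|(\mu+1)(\mu-7)-\nu^2\right|\geq e^4-3e^3+\frac{13e^2}{4}-\frac{3e}{4}-\frac{3}{e}+2-2\sin(1).$$ Then $\mathfrak{h}_{\mu,\nu}\in\mathscr{K}_e$.
   Context: $\mathbb{D}=\{z\in\mathbb{C}:|z|<1\}$. For analytic functions $f,g$ on $\mathbb{D}$, $f\prec g$ ($f$ is subordinate to $g$) means there is an analytic $w:\mathbb{D}\to\mathbb{C}$ with $w(0)=0$, $|w(z)|<1$ for all $z\in\mathbb{D}$ and $f=g\circ w$. $\mathscr{P}_e$ is the family of analytic functions $p$ in $\mathbb{D}$ with $p(0)=1$ and $p(z)\prec e^z$. $\mathscr{A}$ is the class of analytic functions $f$ on $\mathbb{D}$ with $f(0)=0$, $f'(0)=1$. $\mathscr{K}_e$ (exponential convex functions) is the class of $f\in\mathscr{A}$ such that $1+zf''(z)/f'(z)$ belongs to $\mathscr{P}_e$. For $\mu\pm\nu$ not negative odd integers, the Lommel function of the first kind is $\mathfrak{s}_{\mu,\nu}(z)=\frac{z^{\mu+1}}{(\mu-\nu+1)(\mu+\nu+1)}\,{}_1F_2\!\left(1;\frac{\mu-\nu+3}{2},\frac{\mu+\nu+3}{2};-\frac{z^2}{4}\right)$,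 and its normalization is $\mathfrak{h}_{\mu,\nu}(z)=(\mu-\nu+1)(\mu+\nu+1)z^{(1-\mu)/2}\mathfrak{s}_{\mu,\nu}(\sqrt z)$, i.e. $$\mathfrak{h}_{\mu,\nu}(z)=z+\sum_{n\ge1}\frac{(-1/4)^n}{((\mu-\nu+3)/2)_n((\mu+\nu+3)/2)_n}z^{n+1}\qquad(z\in\mathbb{D}),$$ where $(x)_n=x(x+1)\cdots(x+n-1)$. One has $\mathfrak{h}_{\mu,\nu}\in\mathscr{A}$. *)

(* Defs.v *)
From Stdlib Require Import Reals.
From Coquelicot Require Import Coquelicot.
Open Scope R_scope.

Definition in_disk (z : C) : Prop := Cmod z < 1.

(** Functions on the disk are represented by total functions [C -> C]; their
    values outside the disk never matter.  [ex_derive] is taken here over the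
    field of complex numbers, i.e. it is complex differentiability. *)
Definition analytic_on_disk (f : C -> C) : Prop :=
  forall z : C, in_disk z -> ex_derive (K := C_AbsRing) (V := C_NormedModule) f z.

Definition subordinate (f g : C -> C) : Prop :=
  exists w : C -> C,
    analytic_on_disk w /\ w 0 = 0 /\
    (forall z : C, in_disk z -> Cmod (w z) < 1) /\
    (forall z : C, in_disk z -> f z = g (w z)).

Definition Cexp (z : C) : C := (exp (Re z) * cos (Im z), exp (Re z) * sin (Im z)).

Definition class_Pe (p : C -> C) : Prop :=
  analytic_on_disk p /\ p 0 = 1 /\ subordinate p Cexp.

Definition class_A (f : C -> C) : Prop :=
  analytic_on_disk f /\ f 0 = 0 /\ C_derive f 0 = 1.

(** [C_derive] is total; by [C_derive_correct] it is the complex derivative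
    wherever that exists.  Division by zero is total too, so the
    requirement that [f'] has no zero, implicit in the expression
    [1 + z f''(z) / f'(z)] being an analytic function on the disk, is explicit. *)
Definition class_Ke (f : C -> C) : Prop :=
  class_A f /\
  (forall z : C, in_disk z -> C_derive f z <> 0) /\
  class_Pe (fun z : C => 1 + z * C_derive (C_derive f) z / C_derive f z)%C.

(** Sum of a complex series, taken componentwise; see [is_series_CSeries]. *)
Definition CSeries (a : nat -> C) : C :=
  (Series (fun n => Re (a n)), Series (fun n => Im (a n))).

(** [(x)_n = x (x + 1) ... (x + n - 1)] *)
Fixpoint pochhammer (x : R) (n : nat) : R :=
  match n with
  | O => 1
  | S m => pochhammer x m * (x + INR m)
  end.

Definition lommel_coef (mu nu : R) (n : nat) : R :=
  (- (1 / 4)) ^ n /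
  (pochhammer ((mu - nu + 3) / 2) n * pochhammer ((mu + nu + 3) / 2) n).

(** The sum over [n >= 1] is reindexed by [S n], [n >= 0]. *)
Definition lommel_h (mu nu : R) (z : C) : C :=
  (z + CSeries (fun n => RtoC (lommel_coef mu nu (S n)) * z ^ (S n + 1)))%C.

Definition neg_odd_integer (x : R) : Prop :=
  exists k : nat, x = - (2 * INR k + 1).

Lemma is_series_CSeries (a : nat -> C) (l : C) :
  is_series (K := C_AbsRing) (V := C_NormedModule) a l -> CSeries a = l.
Proof.
  intros H.
  assert (Hs : forall n, sum_n (G := C_AbelianMonoid) a n =
            (sum_n (fun k => Re (a k)) n, sum_n (fun k => Im (a k)) n)).
  { induction n as [|n IH].
    - rewrite !sum_O. apply surjective_pairing.
    - rewrite !sum_Sn, IH. reflexivity. }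
  destruct l as [x y]. unfold CSeries. f_equal; apply is_series_unique.
  - intros P [e He].
    destruct (H (fun z : C => P (Re z))) as [n0 Hn0].
    + exists e. intros z [Hz _]. apply He, Hz.
    + exists n0. intros n Hn. specialize (Hn0 n Hn). rewrite Hs in Hn0. exact Hn0.
  - intros P [e He].
    destruct (H (fun z : C => P (Im z))) as [n0 Hn0].
    + exists e. intros z [_ Hz]. apply He, Hz.
    + exists n0. intros n Hn. specialize (Hn0 n Hn). rewrite Hs in Hn0. exact Hn0.
Qed.

(* Main.v *)
Require Import Defs.
From Stdlib Require Import Reals Psatz.
From Coquelicot Require Import Coquelicot.
Open Scope R_scope.

(** Why the theorem holds.  With [c_n = lommel_coef mu nu n], one has
    [|c_n| = 1 / prod_(k < n) |(mu + 3 + 2 k)^2 - nu^2|], whose first factor is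
    [N = (mu + 3)^2 - nu^2].  The last hypothesis is so strong that it alone
    forces [mu + 3 > 0] and [N >= 36] ([lommel_parameter_bounds]): the right
    side exceeds [8], which makes [mu] large, and
    [N = 12 mu + 16 + X] with [X = (mu + 1)(mu - 7) - nu^2], where [|X|] is
    bounded by a multiple of [mu].  Hence [|c_n| <= 36^(-n)]
    ([Rabs_lommel_coef_le]), and [h(z) = sum c_n z^(n+1)] is a small
    perturbation of the identity: on the disk [|h' - 1| <= 1/17] and
    [|z h''| <= 1/8], so [|z h'' / h'| <= 1/4] ([class_Ke_CPSeries]).

    A function [p] with [p(0) = 1] and [|p - 1| <= 1/4] on the disk is
    subordinate to [exp]: the Schwarz function is [w = Log p] with the
    principal logarithm, and [|Log(1 + u)| < 1] as soon as [|u| <= 1/4]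
    ([class_Pe_near_1]).

    Two pieces of complex analysis carry this argument.  A power series is
    complex differentiable inside its disk of convergence, with the termwise
    derivative ([is_Cderive_CPSeries]); the error in the difference quotient is
    dominated by the series of second derivatives.  The principal logarithm is
    holomorphic on the right half-plane ([is_Cderive_Clog]); this comes from the
    Cauchy-Riemann equations for [ln |z|] and [atan (y / x)]. *)

(** * Complex differentiation *)

Notation is_Cderive f z l :=
  (is_derive (K := C_AbsRing) (V := C_NormedModule) f z l).

Lemma is_Cderive_intro (f : C -> C) (z l : C) :
  (forall eps : R, 0 < eps -> exists delta : R, 0 < delta /\
     forall y : C, Cmod (y - z) < delta ->
       Cmod (f y - f z - (y - z) * l) <= eps * Cmod (y - z)) ->
  is_Cderive f z l.
Proof.
  intros H. split; [apply is_linear_scal_l|].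
  intros x Hx eps.
  apply (is_filter_lim_locally_unique (V := AbsRing_NormedModule C_AbsRing)) in Hx.
  subst x.
  destruct (H eps (cond_pos eps)) as [d [Hd Hb]].
  exists (mkposreal d Hd). intros y Hy. exact (Hb y Hy).
Qed.

(** The field [C] carries two normed structures over itself, one from its
    absolute value and one from the product [R * R].  They have the same norm,
    which is all that differentiability sees; this bridge makes the product and
    chain rules, stated for the first structure, available for the second. *)
Lemma is_Cderive_AbsRing (f : C -> C) (z l : C) :
  is_Cderive f z l <->
  is_derive (K := C_AbsRing) (V := AbsRing_NormedModule C_AbsRing) f z l.
Proof.
  split; intros [[H1 H2 H3] H]; split; try exact H; constructor; assumption.
Qed.

Lemma is_Cderive_plus (f g : C -> C) (z lf lg : C) :
  is_Cderive f z lf -> is_Cderive g z lg ->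
  is_Cderive (fun y => f y + g y)%C z (lf + lg)%C.
Proof. exact (is_derive_plus f g z lf lg). Qed.

Lemma is_Cderive_mult (f g : C -> C) (z lf lg : C) :
  is_Cderive f z lf -> is_Cderive g z lg ->
  is_Cderive (fun y => f y * g y)%C z (lf * g z + f z * lg)%C.
Proof.
  rewrite !is_Cderive_AbsRing. intros Hf Hg.
  exact (is_derive_mult (K := C_AbsRing) f g z lf lg Hf Hg Cmult_comm).
Qed.

Lemma is_Cderive_comp (f g : C -> C) (z lf lg : C) :
  is_Cderive f (g z) lf -> is_Cderive g z lg ->
  is_Cderive (fun y => f (g y)) z (lg * lf)%C.
Proof.
  intros Hf Hg. apply is_Cderive_AbsRing in Hg.
  exact (is_derive_comp (K := C_AbsRing) (V := C_NormedModule) f g z lf lg Hf Hg).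
Qed.

Lemma is_Cderive_id (z : C) : is_Cderive (fun y => y) z (RtoC 1).
Proof. apply is_Cderive_AbsRing. exact (is_derive_id (K := C_AbsRing) z). Qed.

Lemma is_Cderive_const (c z : C) : is_Cderive (fun _ => c) z (RtoC 0).
Proof. exact (is_derive_const (K := C_AbsRing) (V := C_NormedModule) c z). Qed.

Lemma Cmod_ge_sub (y z : C) : Cmod z - Cmod (y - z) <= Cmod y.
Proof.
  assert (H := Cmod_triangle y (-(y - z))%C).
  replace (y + - (y - z))%C with z in H by ring.
  rewrite Cmod_opp in H. lra.
Qed.

(** The error of the linear approximation is exactly
    [(y - z)^2 / (y z^2)], and [|y| >= |z| / 2] near [z]. *)
Lemma is_Cderive_inv (z : C) :
  z <> 0 -> is_Cderive Cinv z (- / (z * z))%C.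
Proof.
  intros Hz. apply is_Cderive_intro. intros eps Heps.
  assert (Hm : 0 < Cmod z) by now apply Cmod_gt_0.
  set (m := Cmod z) in *.
  exists (Rmin (m / 2) (eps * m ^ 3 / 2)). split.
  { apply Rmin_pos; [lra|]. assert (0 < m ^ 3) by now apply pow_lt. nra. }
  intros y Hy.
  assert (H1 := Rmin_l (m / 2) (eps * m ^ 3 / 2)).
  assert (H2 := Rmin_r (m / 2) (eps * m ^ 3 / 2)).
  assert (Hym := Cmod_ge_sub y z). fold m in Hym.
  assert (Hy0 : y <> 0) by (apply Cmod_gt_0; lra).
  replace (/ y - / z - (y - z) * - / (z * z))%C
    with ((y - z) * (y - z) / (y * (z * z)))%C by (field; now split).
  rewrite Cmod_div, !Cmod_mult by (repeat apply Cmult_neq_0; assumption).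
  fold m. set (d := Cmod (y - z)) in *.
  assert (Hd : 0 <= d) by apply Cmod_ge_0.
  apply Rle_div_l; [apply Rmult_lt_0_compat; nra|].
  assert (m ^ 3 = m * m * m) by ring.
  assert (m / 2 * (m * m) <= Cmod y * (m * m)) by (apply Rmult_le_compat_r; nra).
  assert (d <= eps * (Cmod y * (m * m))) by nra.
  nra.
Qed.

(** With [u_x = v_y = p] and [v_x = - u_y = q], the real differential of
    [(u, v)] is multiplication by [p + i q]; the modulus of the error is at most
    the sum of the errors of the two components. *)
Lemma is_Cderive_Cauchy_Riemann (u v : R -> R -> R) (z : C) (p q : R) :
  differentiable_pt_lim u (fst z) (snd z) p (- q) ->
  differentiable_pt_lim v (fst z) (snd z) q p ->
  is_Cderive (fun y => (u (fst y) (snd y), v (fst y) (snd y))) z (p, q).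
Proof.
  intros Hu Hv. apply is_Cderive_intro. intros eps Heps.
  assert (He : 0 < eps / 2) by lra.
  destruct (Hu (mkposreal _ He)) as [du Du].
  destruct (Hv (mkposreal _ He)) as [dv Dv].
  exists (Rmin du dv). split; [apply Rmin_pos; apply cond_pos|].
  intros y Hy. simpl in Du, Dv.
  assert (H1 := Rmin_l du dv). assert (H2 := Rmin_r du dv).
  assert (HM := Rmax_Cmod (y - z)%C).
  assert (Hl := Rmax_l (Rabs (fst (y - z)%C)) (Rabs (snd (y - z)%C))).
  assert (Hr := Rmax_r (Rabs (fst (y - z)%C)) (Rabs (snd (y - z)%C))).
  change (fst (y - z)%C) with (fst y - fst z) in *.
  change (snd (y - z)%C) with (snd y - snd z) in *.
  specialize (Du (fst y) (snd y)). specialize (Dv (fst y) (snd y)).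
  assert (Bu := Du ltac:(lra) ltac:(lra)). assert (Bv := Dv ltac:(lra) ltac:(lra)).
  match goal with |- Cmod ?c <= _ =>
    assert (Hc : Cmod c <= Rabs (fst c) + Rabs (snd c)) end.
  { rewrite (surjective_pairing (_ - _ - _)%C) at 1.
    match goal with |- Cmod (?a, ?b) <= _ =>
      replace (a, b) with (RtoC a + Ci * RtoC b)%C end.
    - eapply Rle_trans; [apply Cmod_triangle|].
      rewrite Cmod_mult, Cmod_Ci, !Cmod_R. lra.
    - unfold RtoC, Cplus, Cmult; simpl. f_equal; ring. }
  eapply Rle_trans; [exact Hc|]. simpl.
  replace (u (fst y) (snd y) + - u (fst z) (snd z) +
     - ((fst y + - fst z) * p - (snd y + - snd z) * q)) with
   (u (fst y) (snd y) - u (fst z) (snd z)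
     - (p * (fst y - fst z) + - q * (snd y - snd z))) by ring.
  replace (v (fst y) (snd y) + - v (fst z) (snd z) +
     - ((fst y + - fst z) * q + (snd y + - snd z) * p)) with
   (v (fst y) (snd y) - v (fst z) (snd z)
     - (q * (fst y - fst z) + p * (snd y - snd z))) by ring.
  nra.
Qed.

(** * The principal logarithm on the right half-plane *)

Definition Clog (z : C) : C :=
  (ln (fst z ^ 2 + snd z ^ 2) / 2, atan (snd z / fst z)).

(** Polar coordinates: with [r = |z|], the cosine and sine of [atan (y / x)] are
    [x / r] and [y / r] because [x > 0]. *)
Lemma Cexp_Clog (z : C) : 0 < fst z -> Cexp (Clog z) = z.
Proof.
  destruct z as [x y]; simpl; intros Hx. unfold Cexp, Clog; simpl.
  set (r := sqrt (x ^ 2 + y ^ 2)).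
  assert (Hs : 0 < x ^ 2 + y ^ 2) by nra.
  assert (Hr : 0 < r) by now apply sqrt_lt_R0.
  assert (Hrr : r * r = x ^ 2 + y ^ 2) by (apply sqrt_sqrt; lra).
  replace (x * (x * 1) + y * (y * 1)) with (r * r) by (rewrite Hrr; ring).
  replace (ln (r * r) / 2) with (ln r) by (rewrite ln_mult by assumption; field).
  rewrite exp_ln, cos_atan, sin_atan by assumption.
  replace (sqrt (1 + (y / x)²)) with (r / x).
  - f_equal; field; lra.
  - symmetry. apply sqrt_lem_1.
    + assert (H := Rle_0_sqr (y / x)). lra.
    + apply Rlt_le, Rdiv_lt_0_compat; assumption.
    + replace (r / x * (r / x)) with (r * r / (x * x)) by (field; lra).
      rewrite Hrr. unfold Rsqr. field. lra.
Qed.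

Lemma differentiable_pt_lim_mult (x y : R) :
  differentiable_pt_lim Rmult x y y x.
Proof.
  intros eps. exists eps. intros u v Hu Hv.
  replace (u * v - x * y - (y * (u - x) + x * (v - y)))
    with ((u - x) * (v - y)) by ring.
  rewrite Rabs_mult.
  apply Rmult_le_compat; try apply Rabs_pos; [lra|apply Rmax_r].
Qed.

Lemma differentiable_pt_lim_proj2 (x y : R) :
  differentiable_pt_lim (fun _ v => v) x y 0 1.
Proof.
  intros eps. exists eps. intros u v _ _.
  replace (v - y - (0 * (u - x) + 1 * (v - y))) with 0 by ring.
  rewrite Rabs_R0. apply Rmult_le_pos; [apply Rlt_le, cond_pos|].
  eapply Rle_trans; [apply Rabs_pos|apply Rmax_l].
Qed.

Lemma differentiable_pt_lim_sum_sqr (x y : R) :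
  differentiable_pt_lim (fun u v => u ^ 2 + v ^ 2) x y (2 * x) (2 * y).
Proof.
  intros eps.
  assert (He : 0 < eps / 2) by (assert (H := cond_pos eps); lra).
  exists (mkposreal _ He). simpl. intros u v Hu Hv.
  assert (H1 := Rmax_l (Rabs (u - x)) (Rabs (v - y))).
  assert (H2 := Rmax_r (Rabs (u - x)) (Rabs (v - y))).
  replace (u * (u * 1) + v * (v * 1) - (x * (x * 1) + y * (y * 1))
           - (2 * x * (u - x) + 2 * y * (v - y)))
    with (Rsqr (u - x) + Rsqr (v - y)) by (unfold Rsqr; ring).
  rewrite Rabs_pos_eq by (apply Rplus_le_le_0_compat; apply Rle_0_sqr).
  rewrite (Rsqr_abs (u - x)), (Rsqr_abs (v - y)). unfold Rsqr.
  assert (Hpu := Rabs_pos (u - x)). assert (Hpv := Rabs_pos (v - y)).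
  nra.
Qed.

(** The partial derivatives are those of [/ z = (x - i y) / (x^2 + y^2)].  The
    two-variable chain rule needs a second inner function even where the outer
    one has a single argument; the projection [y] fills that place. *)
Lemma is_Cderive_Clog (z : C) : 0 < fst z -> is_Cderive Clog z (/ z)%C.
Proof.
  intros Hx.
  assert (Hs : 0 < fst z ^ 2 + snd z ^ 2) by nra.
  apply (is_Cderive_Cauchy_Riemann (fun x y => ln (x ^ 2 + y ^ 2) / 2)
           (fun x y => atan (y / x))).
  - evar (p : R). evar (q : R).
    assert (H : differentiable_pt_lim (fun x y => ln (x ^ 2 + y ^ 2) / 2)
        (fst z) (snd z) p q).
    { apply (differentiable_pt_lim_comp (fun t _ => ln t / 2)
               (fun x y => x ^ 2 + y ^ 2) (fun _ y => y)).
      - apply differentiable_pt_lim_proj1_0, is_derive_Reals.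
        auto_derive; [exact Hs|reflexivity].
      - apply differentiable_pt_lim_sum_sqr.
      - apply differentiable_pt_lim_proj2. }
    unfold p, q in H. clear p q.
    match type of H with differentiable_pt_lim _ _ _ ?a ?b =>
      match goal with |- differentiable_pt_lim _ _ _ ?c ?d =>
        replace c with a by (simpl; field; lra); replace d with b by (simpl; field; lra)
      end end.
    exact H.
  - evar (p : R). evar (q : R).
    assert (H : differentiable_pt_lim (fun x y => atan (/ x * y))
        (fst z) (snd z) p q).
    { apply (differentiable_pt_lim_comp (fun t _ => atan t)
               (fun x y => / x * y) (fun _ y => y)).
      - apply differentiable_pt_lim_proj1_0, derivable_pt_lim_atan.
      - apply (differentiable_pt_lim_comp Rmult (fun x _ => / x) (fun _ y => y)).
        + apply differentiable_pt_lim_mult.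
        + apply differentiable_pt_lim_proj1_0, is_derive_Reals.
          auto_derive; [lra|reflexivity].
        + apply differentiable_pt_lim_proj2.
      - apply differentiable_pt_lim_proj2. }
    apply (differentiable_pt_lim_ext (fun x y => atan (/ x * y))).
    { exists (mkposreal 1 Rlt_0_1). intros u v _ _. f_equal. apply Rmult_comm. }
    unfold p, q in H. clear p q.
    assert (1 + (/ fst z * snd z)² <> 0)
      by (assert (Hq := Rle_0_sqr (/ fst z * snd z)); lra).
    match type of H with differentiable_pt_lim _ _ _ ?a ?b =>
      match goal with |- differentiable_pt_lim _ _ _ ?c ?d =>
        replace c with a by (simpl; unfold Rsqr; field; split; nra); replace d with b by (simpl; unfold Rsqr; field; split; nra)
      end end.
    exact H.
Qed.

Lemma Rabs_atan_le (x : R) : Rabs (atan x) <= Rabs x.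
Proof.
  assert (H := bounded_variation atan (fun t => / (1 + t²)) 1 0 x).
  rewrite atan_0, !Rminus_0_r, Rmult_1_l in H. apply H. intros t _.
  assert (Ht := Rle_0_sqr t). split.
  - apply is_derive_atan.
  - rewrite Rabs_inv, Rabs_pos_eq by lra.
    rewrite <- Rinv_1. apply Rinv_le_contravar; lra.
Qed.

(** The real part [ln |1 + u|^2 / 2] is controlled by [ln s <= s - 1] applied to
    [s = |1 + u|^2] and to [/ s], the argument by [|atan t| <= |t|]; the sum of
    the squares [(2/5)^2 + (1/3)^2] is below [1]. *)
Lemma Cmod_Clog_lt_1 (u : C) : Cmod u <= 1 / 4 -> Cmod (Clog (1 + u)%C) < 1.
Proof.
  destruct u as [x y]. intros Hu.
  assert (HM := Rmax_Cmod (x, y)). simpl in HM.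
  assert (Hx := Rmax_l (Rabs x) (Rabs y)). assert (Hy := Rmax_r (Rabs x) (Rabs y)).
  assert (Bx : Rabs x <= 1 / 4) by lra. assert (By : Rabs y <= 1 / 4) by lra.
  apply Rabs_le_between in Bx.
  change (sqrt ((ln ((1 + x) ^ 2 + (0 + y) ^ 2) / 2) ^ 2
                + atan ((0 + y) / (1 + x)) ^ 2) < 1).
  rewrite Rplus_0_l.
  set (s := (1 + x) ^ 2 + y ^ 2).
  assert (Hs : 9 / 16 <= s <= 7 / 4).
  { apply Rabs_le_between in By. unfold s. split; nra. }
  assert (Hln : Rabs (ln s / 2) <= 2 / 5).
  { apply Rabs_le_between. split.
    - assert (H : ln (/ s) <= / s - 1).
      { rewrite <- (ln_exp (/ s - 1)). apply ln_le; [apply Rinv_0_lt_compat; lra|].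
        assert (H := exp_ineq1_le (/ s - 1)). lra. }
      rewrite ln_Rinv in H by lra.
      assert (/ s <= / (9 / 16)) by (apply Rinv_le_contravar; lra).
      replace (/ (9 / 16)) with (16 / 9) in * by field. lra.
    - assert (H : ln s <= s - 1).
      { rewrite <- (ln_exp (s - 1)). apply ln_le; [lra|].
        assert (H := exp_ineq1_le (s - 1)). lra. }
      lra. }
  assert (Hat : Rabs (atan (y / (1 + x))) <= 1 / 3).
  { eapply Rle_trans; [apply Rabs_atan_le|]. unfold Rdiv at 1.
    rewrite Rabs_mult, Rabs_inv, (Rabs_pos_eq (1 + x)) by lra.
    apply Rle_div_l; lra. }
  apply Rlt_le_trans with (sqrt 1); [|rewrite sqrt_1; lra].
  apply sqrt_lt_1_alt.
  rewrite <- (pow2_abs (ln s / 2)), <- (pow2_abs (atan _)).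
  assert (H1 := Rabs_pos (ln s / 2)). assert (H2 := Rabs_pos (atan (y / (1 + x)))).
  split; nra.
Qed.

(** * Complex power series with real coefficients *)

Notation is_Cseries c l :=
  (is_series (K := C_AbsRing) (V := C_NormedModule) c l).

Lemma is_Cseries_dominated (c : nat -> C) (b : nat -> R) :
  (forall n, Cmod (c n) <= b n) -> ex_series b -> is_Cseries c (CSeries c).
Proof.
  intros Hc Hb.
  destruct (ex_series_le (K := C_AbsRing) (V := C_CompleteNormedModule) c b Hc Hb)
    as [l Hl].
  rewrite (is_series_CSeries c l Hl). exact Hl.
Qed.

Lemma Cmod_is_Cseries_le (c : nat -> C) (l : C) (b : nat -> R) :
  is_Cseries c l -> (forall n, Cmod (c n) <= b n) -> ex_series b ->
  Cmod l <= Series b.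
Proof.
  intros Hl Hc Hb.
  assert (Hn : is_lim_seq (fun n => Cmod (sum_n c n)) (Cmod l)).
  { exact (filterlim_comp _ _ _ (sum_n c) norm _ _ _ Hl (filterlim_norm l)). }
  assert (Hs : is_lim_seq (sum_n b) (Series b)) by exact (Series_correct b Hb).
  refine (is_lim_seq_le _ _ _ _ _ Hn Hs).
  intros n. unfold sum_n. eapply Rle_trans.
  - exact (norm_sum_n_m (K := C_AbsRing) (V := C_NormedModule) c 0 n).
  - apply sum_n_m_le. exact Hc.
Qed.

(** Keeping the coefficients real makes the radius of convergence and the
    coefficientwise derivative of real power series directly applicable. *)
Definition CPSeries (a : nat -> R) (z : C) : C :=
  CSeries (fun n => RtoC (a n) * z ^ n)%C.

Lemma Cmod_pseries_term (a : R) (z : C) (n : nat) :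
  Cmod (RtoC a * z ^ n)%C = Rabs a * Cmod z ^ n.
Proof. now rewrite Cmod_mult, Cmod_R, Cmod_pow. Qed.

Lemma ex_series_abs_inside (a : nat -> R) (r : R) :
  0 <= r -> Rbar_lt r (CV_radius a) -> ex_series (fun n => Rabs (a n) * r ^ n).
Proof.
  intros Hr H. rewrite <- (Rabs_pos_eq r Hr) in H.
  generalize (CV_disk_inside a r H). apply ex_series_ext. intros n.
  rewrite Rabs_mult. f_equal. apply Rabs_pos_eq. now apply pow_le.
Qed.

Lemma is_Cseries_CPSeries (a : nat -> R) (z : C) :
  Rbar_lt (Cmod z) (CV_radius a) ->
  is_Cseries (fun n => RtoC (a n) * z ^ n)%C (CPSeries a z).
Proof.
  intros H. apply (is_Cseries_dominated _ (fun n => Rabs (a n) * Cmod z ^ n)).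
  - intros n. rewrite Cmod_pseries_term. apply Rle_refl.
  - apply ex_series_abs_inside; [apply Cmod_ge_0|exact H].
Qed.

Lemma Cmod_pow_sub_le (y z : C) (r : R) (n : nat) :
  Cmod y <= r -> Cmod z <= r ->
  Cmod (y ^ S n - z ^ S n)%C <= INR (S n) * r ^ n * Cmod (y - z).
Proof.
  intros Hy Hz. assert (Hd := Cmod_ge_0 (y - z)%C).
  assert (Hr : 0 <= r) by (assert (H := Cmod_ge_0 y); lra).
  induction n as [|n IH].
  - simpl. rewrite !Cmult_1_r. lra.
  - replace (y ^ S (S n) - z ^ S (S n))%C
      with (y * (y ^ S n - z ^ S n) + (y - z) * z ^ S n)%C
      by (rewrite !Cpow_S; ring).
    eapply Rle_trans; [apply Cmod_triangle|].
    rewrite !Cmod_mult, Cmod_pow, (S_INR (S n)).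
    assert (Hp : Cmod z ^ S n <= r ^ S n)
      by (apply pow_incr; split; [apply Cmod_ge_0|exact Hz]).
    assert (H1 : Cmod y * Cmod (y ^ S n - z ^ S n)%C
             <= r * (INR (S n) * r ^ n * Cmod (y - z)%C))
      by (apply Rmult_le_compat; auto using Cmod_ge_0).
    assert (H2 := Rmult_le_compat_l _ _ _ Hd Hp).
    simpl in *. nra.
Qed.

(** First-order Taylor formula for [y^m], [m = n + 2], with a bound that is
    uniform for [y], [z] in the disk of radius [r].  The induction multiplies
    the remainder by [z] and adds [(y - z) (y^m - z^m)], which
    [Cmod_pow_sub_le] controls. *)
Lemma Cmod_pow_taylor_le (y z : C) (r : R) (n : nat) :
  Cmod y <= r -> Cmod z <= r ->
  Cmod (y ^ S (S n) - z ^ S (S n) - (y - z) * (RtoC (INR (S (S n))) * z ^ S n))%C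
    <= INR (S n) * INR (S (S n)) * r ^ n * (Cmod (y - z) * Cmod (y - z)).
Proof.
  intros Hy Hz. assert (Hd := Cmod_ge_0 (y - z)%C).
  assert (Hr : 0 <= r) by (assert (H := Cmod_ge_0 y); lra).
  induction n as [|n IH].
  - simpl. replace (_ - _ - _)%C with ((y - z) * (y - z))%C.
    + rewrite Cmod_mult. nra.
    + rewrite RtoC_plus. ring.
  - replace (y ^ S (S (S n)) - z ^ S (S (S n))
             - (y - z) * (RtoC (INR (S (S (S n)))) * z ^ S (S n)))%C
      with (z * (y ^ S (S n) - z ^ S (S n)
                 - (y - z) * (RtoC (INR (S (S n))) * z ^ S n))
            + (y - z) * (y ^ S (S n) - z ^ S (S n)))%C
      by (rewrite (S_INR (S (S n))), RtoC_plus, !Cpow_S; ring).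
    eapply Rle_trans; [apply Cmod_triangle|]. rewrite !(Cmod_mult z), Cmod_mult.
    assert (H1 := Rmult_le_compat _ _ _ _ (Cmod_ge_0 z) (Cmod_ge_0 _) Hz IH).
    assert (H2 := Rmult_le_compat_l _ _ _ Hd (Cmod_pow_sub_le y z r (S n) Hy Hz)).
    eapply Rle_trans; [exact (Rplus_le_compat _ _ _ _ H1 H2)|].
    rewrite (S_INR (S (S n))), (S_INR (S n)).
    set (k := INR (S n)). set (d := Cmod (y - z)%C) in *.
    assert (Hk : 0 <= k) by apply pos_INR.
    assert (Hp : 0 <= r ^ S n * (d * d)) by (apply Rmult_le_pos; [now apply pow_le|nra]).
    replace (r * (k * (k + 1) * r ^ n * (d * d)) + d * ((k + 1) * r ^ S n * d))
      with ((k + 1) * (k + 1) * (r ^ S n * (d * d))) by (simpl; ring).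
    replace ((k + 1) * (k + 1 + 1) * r ^ S n * (d * d))
      with ((k + 1) * (k + 1 + 1) * (r ^ S n * (d * d))) by ring.
    apply Rmult_le_compat_r; [exact Hp|nra].
Qed.

(** Choose [r] strictly between [|z|] and the radius of convergence.  By
    [Cmod_pow_taylor_le], for [|y| <= r] the error in the linear approximation
    at [z] is at most [|y - z|^2 * sum n (n - 1) |a_n| r^(n - 2)], a finite
    multiple of [|y - z|^2] since differentiating the coefficients twice does
    not change the radius. *)
Lemma is_Cderive_CPSeries (a : nat -> R) (z : C) :
  Rbar_lt (Cmod z) (CV_radius a) ->
  is_Cderive (CPSeries a) z (CPSeries (PS_derive a) z).
Proof.
  intros Hz.
  assert (Hr : exists r, Cmod z < r /\ Rbar_lt r (CV_radius a)).
  { destruct (CV_radius a) as [R| |]; simpl in Hz.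
    - exists ((Cmod z + R) / 2). simpl. lra.
    - exists (Cmod z + 1). simpl. split; [lra|exact I].
    - contradiction. }
  destruct Hr as [r [Hzr Hra]].
  assert (Hr0 : 0 <= r) by (assert (H := Cmod_ge_0 z); lra).
  set (b := fun n => Rabs (PS_derive (PS_derive a) n) * r ^ n).
  assert (Hb : ex_series b).
  { apply ex_series_abs_inside; [exact Hr0|]. now rewrite !CV_radius_derive. }
  assert (HS : 0 <= Series b).
  { rewrite <- (Rmult_0_l (Series b)), <- Series_scal_l.
    apply Series_le; [|exact Hb]. intros n. rewrite Rmult_0_l.
    split; [apply Rle_refl|]. apply Rmult_le_pos; [apply Rabs_pos|now apply pow_le]. }
  apply is_Cderive_intro. intros eps Heps.
  exists (Rmin (r - Cmod z) (eps / (Series b + 1))). split.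
  { apply Rmin_pos; [lra|]. apply Rdiv_lt_0_compat; lra. }
  intros y Hy.
  assert (Hy1 := Rlt_le_trans _ _ _ Hy (Rmin_l _ _)).
  assert (Hy2 := Rlt_le_trans _ _ _ Hy (Rmin_r _ _)). clear Hy.
  assert (Hyr : Cmod y < r).
  { assert (H := Cmod_triangle z (y - z)%C).
    replace (z + (y - z))%C with y in H by ring. lra. }
  assert (Hya : Rbar_lt (Cmod y) (CV_radius a))
    by (eapply Rbar_lt_trans; [|exact Hra]; exact Hyr).
  assert (Hz' : Rbar_lt (Cmod z) (CV_radius (PS_derive a)))
    by now rewrite CV_radius_derive.
  set (d := (y - z)%C) in *.
  (* The shift by one place aligns the derivative with the powers of [y] and
     [z] of the same index; the terms of index 0 and 1 then cancel. *)
  assert (HD : is_Cseries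
    (fun n => match n with O => RtoC 0
              | S k => d * (RtoC (PS_derive a k) * z ^ k) end)%C
    (d * CPSeries (PS_derive a) z)%C).
  { apply (is_series_decr_1 (K := C_AbsRing) (V := C_NormedModule)).
    replace (plus _ _) with (d * CPSeries (PS_derive a) z)%C.
    - apply (is_series_scal (K := C_AbsRing) (V := C_NormedModule) d).
      now apply is_Cseries_CPSeries.
    - unfold plus, opp; simpl. ring. }
  set (t := fun n => (RtoC (a n) * y ^ n - RtoC (a n) * z ^ n
    - match n with O => RtoC 0
      | S k => d * (RtoC (PS_derive a k) * z ^ k) end)%C).
  set (E := (CPSeries a y - CPSeries a z - d * CPSeries (PS_derive a) z)%C).
  assert (HE : is_Cseries t E).
  { exact (is_series_minus _ _ _ _ (is_series_minus _ _ _ _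
      (is_Cseries_CPSeries a y Hya) (is_Cseries_CPSeries a z Hz)) HD). }
  assert (HE2 : is_Cseries (fun k => t (2 + k)%nat) E).
  { apply (is_series_incr_n (K := C_AbsRing) (V := C_NormedModule) t 2); [lia|].
    replace (plus E _) with E; [exact HE|].
    simpl. rewrite sum_Sn, sum_O. unfold t, plus, PS_derive; simpl.
    unfold d. rewrite !Rmult_1_l. ring. }
  assert (Hle : Cmod E <= Series (fun n => (Cmod d * Cmod d) * b n)).
  { refine (Cmod_is_Cseries_le _ _ _ HE2 _ _).
    - intros n.
      change (Cmod (RtoC (a (S (S n))) * y ^ S (S n) - RtoC (a (S (S n))) * z ^ S (S n)
                - d * (RtoC (INR (S (S n)) * a (S (S n))) * z ^ S n))%C
              <= Cmod d * Cmod d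
                * (Rabs (INR (S n) * (INR (S (S n)) * a (S (S n)))) * r ^ n)).
      replace (_ - _ - _)%C with (RtoC (a (S (S n))) *
         (y ^ S (S n) - z ^ S (S n)
          - (y - z) * (RtoC (INR (S (S n))) * z ^ S n)))%C
        by (rewrite RtoC_mult; unfold d; ring).
      rewrite Cmod_mult, Cmod_R, !Rabs_mult, !(Rabs_pos_eq (INR _)) by apply pos_INR.
      assert (HT := Rmult_le_compat_l _ _ _ (Rabs_pos (a (S (S n))))
        (Cmod_pow_taylor_le y z r n (Rlt_le _ _ Hyr) (Rlt_le _ _ Hzr))).
      fold d in HT |- *. lra.
    - exact (ex_series_scal_l (Cmod d * Cmod d) b Hb). }
  eapply Rle_trans; [exact Hle|]. rewrite Series_scal_l.
  assert (Hd := Cmod_ge_0 d).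
  apply Rlt_div_r in Hy2; [|lra]. nra.
Qed.

(** * Power series close to the identity *)

Lemma in_disk_locally (z : C) :
  in_disk z -> locally (T := AbsRing_UniformSpace C_AbsRing) z in_disk.
Proof.
  intros Hz. assert (Hd : 0 < 1 - Cmod z) by (unfold in_disk in Hz; lra).
  assert (H : forall y : C, Cmod (y - z)%C < 1 - Cmod z -> in_disk y).
  { intros y Hy. assert (H := Cmod_triangle z (y - z)%C).
    replace (z + (y - z))%C with y in H by ring. unfold in_disk. lra. }
  exists (mkposreal _ Hd). exact H.
Qed.

Lemma is_Cderive_ext_disk (f g : C -> C) (z l : C) :
  (forall y, in_disk y -> f y = g y) -> in_disk z ->
  is_Cderive f z l -> is_Cderive g z l.
Proof.
  intros Hfg Hz. apply (is_derive_ext_loc (K := C_AbsRing) (V := C_NormedModule)).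
  apply (filter_imp in_disk); [exact Hfg|now apply in_disk_locally].
Qed.

Lemma in_disk_0 : in_disk 0.
Proof. unfold in_disk. rewrite Cmod_0. lra. Qed.

(** The Schwarz function is [Log p], since [exp (Log p) = p] where [p] has
    positive real part. *)
Lemma class_Pe_near_1 (p : C -> C) :
  analytic_on_disk p -> p 0 = 1 ->
  (forall z, in_disk z -> Cmod (p z - 1)%C <= 1 / 4) -> class_Pe p.
Proof.
  intros Hp Hp0 Hb.
  assert (Hpos : forall z, in_disk z -> 0 < fst (p z)).
  { intros z Hz. assert (H := Hb z Hz).
    assert (HR := re_le_Cmod (p z - 1)%C).
    change (Re (p z - 1)%C) with (fst (p z) - 1) in HR.
    assert (HA := Rabs_le_between (fst (p z) - 1) (1 / 4)).
    assert (H1 : Rabs (fst (p z) - 1) <= 1 / 4) by lra.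
    apply HA in H1. lra. }
  split; [exact Hp|]. split; [exact Hp0|].
  exists (fun z => Clog (p z)). repeat split.
  - intros z Hz. destruct (Hp z Hz) as [l Hl]. eexists.
    apply (is_Cderive_comp Clog p); [|exact Hl].
    apply is_Cderive_Clog, Hpos, Hz.
  - rewrite Hp0. unfold Clog; simpl.
    replace (1 * (1 * 1) + 0 * (0 * 1)) with 1 by ring.
    unfold Rdiv. now rewrite ln_1, !Rmult_0_l, atan_0.
  - intros z Hz. replace (p z) with (1 + (p z - 1))%C by ring.
    apply Cmod_Clog_lt_1, Hb, Hz.
  - intros z Hz. symmetry. apply Cexp_Clog, Hpos, Hz.
Qed.

Lemma CV_radius_gt_1 (a : nat -> R) (c r : R) :
  0 < r < 1 -> (forall n, Rabs (a n) <= c * r ^ n) -> Rbar_lt 1 (CV_radius a).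
Proof.
  intros Hr Ha. apply Rbar_lt_le_trans with (/ r).
  - simpl. rewrite <- Rinv_1. apply Rinv_lt_contravar; lra.
  - apply CV_radius_bounded. exists c. intros n.
    rewrite Rabs_mult, <- RPow_abs, Rabs_inv, (Rabs_pos_eq r) by lra.
    rewrite pow_inv. apply Rle_div_l; [apply pow_lt; lra|apply Ha].
Qed.

Lemma Cmod_CPSeries_le_geom (a : nat -> R) (c r : R) (z : C) :
  0 < r < 1 -> (forall n, Rabs (a n) <= c * r ^ n) -> in_disk z ->
  Cmod (CPSeries a z) <= c / (1 - r).
Proof.
  intros Hr Ha Hz.
  assert (Hc : ex_series (fun n => c * r ^ n)).
  { apply (ex_series_scal_l c (fun n => r ^ n)), ex_series_geom.
    rewrite Rabs_pos_eq; lra. }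
  assert (Hle : forall n, Cmod (RtoC (a n) * z ^ n)%C <= c * r ^ n).
  { intros n. rewrite Cmod_pseries_term. eapply Rle_trans; [|apply Ha].
    rewrite <- (Rmult_1_r (Rabs (a n))) at 2.
    apply Rmult_le_compat_l; [apply Rabs_pos|].
    rewrite <- (pow1 n). apply pow_incr. split; [apply Cmod_ge_0|].
    now apply Rlt_le. }
  eapply Rle_trans.
  - exact (Cmod_is_Cseries_le _ _ _ (is_Cseries_dominated _ _ Hle Hc) Hle Hc).
  - rewrite Series_scal_l, Series_geom; [apply Rle_refl|rewrite Rabs_pos_eq; lra].
Qed.

Lemma CPSeries_decr_1 (a : nat -> R) (z : C) :
  Rbar_lt (Cmod z) (CV_radius a) ->
  CPSeries a z = (RtoC (a 0%nat) + z * CPSeries (PS_decr_1 a) z)%C.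
Proof.
  intros Hz. apply is_series_CSeries.
  apply (is_series_decr_1 (K := C_AbsRing) (V := C_NormedModule)).
  assert (H : is_Cseries (fun n => RtoC (PS_decr_1 a n) * z ^ n)%C
                (CPSeries (PS_decr_1 a) z)).
  { apply is_Cseries_CPSeries. now rewrite CV_radius_decr_1. }
  apply (is_series_scal (K := C_AbsRing) (V := C_NormedModule) z) in H.
  replace (plus _ _) with (scal z (CPSeries (PS_decr_1 a) z)).
  - revert H. apply is_series_ext. intros n.
    unfold PS_decr_1, scal; simpl. unfold mult; simpl. ring.
  - unfold plus, opp, scal; simpl. unfold mult; simpl. ring.
Qed.

Lemma INR_S_le_pow2 (n : nat) : INR (S n) <= 2 ^ n.
Proof.
  induction n as [|n IH]; [simpl; lra|].
  rewrite S_INR. simpl pow. assert (H := pos_INR n). rewrite S_INR in *. lra.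
Qed.

(** Since [n + 1 <= 2^n], each differentiation at most doubles the ratio of a
    geometric bound on the coefficients: [1/36] becomes [1/18] for [f'] and [1/9]
    for [f''].  Summing gives [|f' - 1| <= (1/18) / (1 - 1/18) = 1/17] and
    [|f''| <= (1/9) / (1 - 1/9) = 1/8], so [|z f'' / f'| <= (1/8) (17/16) < 1/4]. *)
Lemma class_Ke_CPSeries (f : C -> C) (b : nat -> R) :
  (forall z, in_disk z -> f z = CPSeries b z) ->
  b 0%nat = 0 -> b 1%nat = 1 ->
  (forall n, Rabs (b (S n)) <= (1 / 36) ^ n) ->
  class_Ke f.
Proof.
  intros Hf b0 b1 Hb.
  set (b' := PS_derive b). set (b'' := PS_derive b').
  assert (Hb' : forall n, Rabs (b' n) <= (1 / 18) ^ n).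
  { intros n. unfold b', PS_derive.
    rewrite Rabs_mult, (Rabs_pos_eq (INR _)) by apply pos_INR.
    replace (1 / 18) with (2 * (1 / 36)) by field. rewrite Rpow_mult_distr.
    apply Rmult_le_compat; auto using pos_INR, Rabs_pos, INR_S_le_pow2. }
  assert (Hb'' : forall n, Rabs (b'' n) <= 1 / 9 * (1 / 9) ^ n).
  { intros n. unfold b'', PS_derive.
    rewrite Rabs_mult, (Rabs_pos_eq (INR _)) by apply pos_INR.
    change (1 / 9 * (1 / 9) ^ n) with ((1 / 9) ^ S n).
    replace (1 / 9) with (2 * (1 / 18)) by field. rewrite Rpow_mult_distr.
    apply Rmult_le_compat; auto using pos_INR, Rabs_pos.
    eapply Rle_trans; [apply INR_S_le_pow2|].
    apply Rle_pow; [lra|lia]. }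
  assert (R1 : Rbar_lt 1 (CV_radius b')).
  { apply (CV_radius_gt_1 b' 1 (1 / 18)); [lra|].
    intros n. rewrite Rmult_1_l. apply Hb'. }
  assert (Hrad : forall z, in_disk z -> Rbar_lt (Cmod z) (CV_radius b')).
  { intros z Hz. exact (Rbar_lt_trans (Cmod z) 1 _ Hz R1). }
  assert (Hrad0 : forall z, in_disk z -> Rbar_lt (Cmod z) (CV_radius b)).
  { intros z Hz. rewrite <- CV_radius_derive. now apply Hrad. }
  assert (Hrad2 : forall z, in_disk z -> Rbar_lt (Cmod z) (CV_radius b'')).
  { intros z Hz. unfold b''. rewrite CV_radius_derive. now apply Hrad. }
  assert (Df : forall z, in_disk z -> is_Cderive f z (CPSeries b' z)).
  { intros z Hz. apply (is_Cderive_ext_disk (CPSeries b)); [|exact Hz|].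
    - intros y Hy. symmetry. now apply Hf.
    - now apply is_Cderive_CPSeries, Hrad0. }
  assert (Ef : forall z, in_disk z -> C_derive f z = CPSeries b' z).
  { intros z Hz. now apply is_C_derive_unique, Df. }
  assert (Df' : forall z, in_disk z ->
            is_Cderive (C_derive f) z (CPSeries b'' z)).
  { intros z Hz. apply (is_Cderive_ext_disk (CPSeries b')); [|exact Hz|].
    - intros y Hy. symmetry. now apply Ef.
    - now apply is_Cderive_CPSeries, Hrad. }
  assert (Ef' : forall z, in_disk z ->
            C_derive (C_derive f) z = CPSeries b'' z).
  { intros z Hz. now apply is_C_derive_unique, Df'. }
  assert (b'0 : b' 0%nat = 1) by (unfold b', PS_derive; rewrite b1; simpl; ring).
  assert (Hnear : forall z, in_disk z -> Cmod (CPSeries b' z - 1)%C <= 1 / 17).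
  { intros z Hz. rewrite CPSeries_decr_1, b'0 by now apply Hrad.
    replace (1 + z * CPSeries (PS_decr_1 b') z - 1)%C
      with (z * CPSeries (PS_decr_1 b') z)%C by ring.
    rewrite Cmod_mult.
    assert (H : Cmod (CPSeries (PS_decr_1 b') z) <= 1 / 18 / (1 - 1 / 18)).
    { apply Cmod_CPSeries_le_geom; [lra| |exact Hz]. intros n. apply Hb'. }
    assert (H0 := Cmod_ge_0 z). assert (H1 := Cmod_ge_0 (CPSeries (PS_decr_1 b') z)).
    unfold in_disk in Hz. nra. }
  assert (Hlow : forall z, in_disk z -> 16 / 17 <= Cmod (CPSeries b' z)).
  { intros z Hz. assert (H := Cmod_ge_sub (CPSeries b' z) 1).
    rewrite Cmod_1 in H. assert (H' := Hnear z Hz). lra. }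
  assert (Hnz : forall z, in_disk z -> CPSeries b' z <> 0).
  { intros z Hz. apply Cmod_gt_0. assert (H := Hlow z Hz). lra. }
  assert (Hnum : forall z, in_disk z -> Cmod (CPSeries b'' z) <= 1 / 8).
  { intros z Hz. replace (1 / 8) with (1 / 9 / (1 - 1 / 9)) by field.
    apply Cmod_CPSeries_le_geom; [lra|exact Hb''|exact Hz]. }
  split; [|split].
  - split; [|split].
    + intros z Hz. eexists. now apply Df.
    + rewrite Hf by exact in_disk_0. rewrite CPSeries_decr_1, b0 by exact (Hrad0 _ in_disk_0).
      ring.
    + rewrite Ef by exact in_disk_0. rewrite CPSeries_decr_1, b'0 by exact (Hrad _ in_disk_0).
      ring.
  - intros z Hz. rewrite Ef by exact Hz. now apply Hnz.
  - apply class_Pe_near_1.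
    + intros z Hz. eexists.
      apply (is_Cderive_ext_disk
        (fun y => 1 + y * (CPSeries b'' y * / CPSeries b' y))%C); [|exact Hz|].
      { intros y Hy. rewrite Ef, Ef' by exact Hy. unfold Cdiv. ring. }
      apply is_Cderive_plus; [apply is_Cderive_const|].
      apply is_Cderive_mult; [apply is_Cderive_id|].
      apply is_Cderive_mult.
      * now apply is_Cderive_CPSeries, Hrad2.
      * apply (is_Cderive_comp Cinv); [now apply is_Cderive_inv, Hnz|].
        now apply is_Cderive_CPSeries, Hrad.
    + unfold Cdiv. ring.
    + intros z Hz. rewrite Ef, Ef' by exact Hz.
      replace (_ - _)%C with (z * (CPSeries b'' z / CPSeries b' z))%C
        by (unfold Cdiv; ring).
      rewrite Cmod_mult, Cmod_div by now apply Hnz.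
      assert (H1 := Hlow z Hz). assert (H2 := Hnum z Hz).
      assert (H3 : Cmod (CPSeries b'' z) / Cmod (CPSeries b' z) <= 1 / 4)
        by (apply Rle_div_l; lra).
      assert (H4 : 0 <= Cmod (CPSeries b'' z) / Cmod (CPSeries b' z)).
      { apply Rdiv_le_0_compat; [apply Cmod_ge_0|lra]. }
      assert (H0 := Cmod_ge_0 z). unfold in_disk in Hz. nra.
Qed.

(** * The Lommel coefficients *)

Lemma exp_1_gt : 2.44 < exp 1.
Proof.
  assert (H := exp_ineq1 (1 / 4) ltac:(lra)).
  replace 1 with (1 / 4 + 1 / 4 + (1 / 4 + 1 / 4)) at 1 by field.
  rewrite !exp_plus. set (x := exp (1 / 4)) in *.
  assert (1.5625 < x * x) by nra. nra.
Qed.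

(** In the variable [t = e - 2.44 > 0] the polynomial part has nonnegative
    coefficients, and [3 / e] decreases. *)
Lemma exp_1_polynomial_gt :
  8 < exp 1 ^ 4 - 3 * exp 1 ^ 3 + 13 * exp 1 ^ 2 / 4 - 3 * exp 1 / 4 - 3 / exp 1.
Proof.
  assert (H := exp_1_gt). set (e := exp 1) in *.
  assert (Hi : 3 / e <= 3 / 2.44).
  { apply Rmult_le_compat_l; [lra|]. apply Rinv_le_contravar; lra. }
  replace e with (2.44 + (e - 2.44)) at 1 2 3 4 by ring.
  set (t := e - 2.44). assert (Ht : 0 < t) by (unfold t; lra).
  assert (0 < t * t) by nra. assert (0 < t * t * t) by nra.
  assert (0 < t * t * t * t) by nra.
  nra.
Qed.

(** Write [X = (mu + 1)(mu - 7) - nu^2].  Since [sin 1 <= 1] and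
    [e (e - 1) / 4 > 0.878], the hypothesis gives [3 mu >= 8 + 0.878 |X|].
    Hence [(mu + 3)^2 - nu^2 = 12 mu + 16 + X] is at least
    [12 mu + 16 - |X| >= 48 + 2.5 |X|]. *)
Lemma lommel_parameter_bounds (mu nu : R) :
  mu * (1 + 2 * sin 1)
    - 1 / 4 * exp 1 * (exp 1 - 1) * Rabs ((mu + 1) * (mu - 7) - nu ^ 2)
  >= exp 1 ^ 4 - 3 * exp 1 ^ 3 + 13 * exp 1 ^ 2 / 4 - 3 * exp 1 / 4
     - 3 / exp 1 + 2 - 2 * sin 1 ->
  0 < mu + 3 /\ 36 <= (mu + 3) ^ 2 - nu ^ 2.
Proof.
  intros H. assert (HP := exp_1_polynomial_gt). assert (He := exp_1_gt).
  assert (Hs := SIN_bound 1).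
  assert (Hs0 : 0 < sin 1).
  { apply sin_gt_0; [lra|]. assert (Hpi := PI2_3_2). unfold PI2 in Hpi. lra. }
  set (X := (mu + 1) * (mu - 7) - nu ^ 2) in *.
  set (s := sin 1) in *. set (k := 1 / 4 * exp 1 * (exp 1 - 1)) in *.
  assert (Hk : 0.878 < k) by (unfold k; nra).
  assert (HX := Rabs_pos X).
  assert (HX' : - Rabs X <= X) by (assert (Q := Rabs_le_between X (Rabs X)); lra).
  assert (HkX : 0.878 * Rabs X <= k * Rabs X) by (apply Rmult_le_compat_r; lra).
  assert (Hm : 8 + 0.878 * Rabs X <= mu * (1 + 2 * s)) by lra.
  assert (Hmu : 0 < mu) by nra.
  assert (Hm3 : 8 + 0.878 * Rabs X <= mu * 3) by nra.
  split; [lra|].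
  replace ((mu + 3) ^ 2 - nu ^ 2) with (12 * mu + 16 + X) by (unfold X; ring).
  lra.
Qed.

Lemma pochhammer_prod_ge (x y q : R) (n : nat) :
  0 < x -> 0 < y -> 0 <= q <= x * y ->
  q ^ n <= pochhammer x n * pochhammer y n.
Proof.
  intros Hx Hy Hq. induction n as [|n IH]; simpl; [lra|].
  replace (pochhammer x n * (x + INR n) * (pochhammer y n * (y + INR n)))
    with ((x + INR n) * (y + INR n) * (pochhammer x n * pochhammer y n)) by ring.
  assert (Hn := pos_INR n).
  apply Rmult_le_compat; [lra|apply pow_le; lra|nra|exact IH].
Qed.

(** The two Pochhammer bases have positive sum [mu + 3] and product
    [((mu + 3)^2 - nu^2) / 4 >= 9], so both are positive and the factors of the
    denominator only grow with the index. *)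
Lemma Rabs_lommel_coef_le (mu nu : R) (n : nat) :
  0 < mu + 3 -> 36 <= (mu + 3) ^ 2 - nu ^ 2 ->
  Rabs (lommel_coef mu nu n) <= (1 / 36) ^ n.
Proof.
  intros Hmu HN. unfold lommel_coef.
  set (x := (mu - nu + 3) / 2). set (y := (mu + nu + 3) / 2).
  assert (Hxy : 9 <= x * y) by (unfold x, y; nra).
  assert (Hsum : 0 < x + y) by (unfold x, y; lra).
  assert (Hx : 0 < x) by nra. assert (Hy : 0 < y) by nra.
  assert (HP := pochhammer_prod_ge x y 9 n Hx Hy ltac:(lra)).
  assert (H9 : 0 < 9 ^ n) by (apply pow_lt; lra).
  unfold Rdiv at 1. rewrite Rabs_mult, <- RPow_abs, Rabs_Ropp, Rabs_inv.
  rewrite (Rabs_pos_eq (1 / 4)), (Rabs_pos_eq (_ * _)) by lra.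
  replace (1 / 36) with (1 / 4 * / 9) by field.
  rewrite Rpow_mult_distr, pow_inv.
  apply Rmult_le_compat_l; [apply pow_le; lra|].
  apply Rinv_le_contravar; assumption.
Qed.

(** The shifted coefficients absorb the leading term [z], because the coefficient
    of index [0] is [1]. *)
Lemma lommel_h_CPSeries (mu nu : R) (z : C) :
  Rbar_lt (Cmod z) (CV_radius (lommel_coef mu nu)) ->
  lommel_h mu nu z = CPSeries (PS_incr_1 (lommel_coef mu nu)) z.
Proof.
  intros Hz. set (c := lommel_coef mu nu) in *.
  assert (Hc0 : c 0%nat = 1) by (unfold c, lommel_coef; simpl; field).
  rewrite CPSeries_decr_1 by now rewrite CV_radius_incr_1.
  change (PS_decr_1 (PS_incr_1 c)) with c.
  rewrite CPSeries_decr_1, Hc0 by exact Hz. unfold lommel_h.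
  rewrite (is_series_CSeries _ (z ^ 2 * CPSeries (PS_decr_1 c) z)%C).
  { change (PS_incr_1 c 0%nat) with 0. simpl. ring. }
  assert (H : is_Cseries (fun n => RtoC (PS_decr_1 c n) * z ^ n)%C
                (CPSeries (PS_decr_1 c) z)).
  { apply is_Cseries_CPSeries. now rewrite CV_radius_decr_1. }
  apply (is_series_scal (K := C_AbsRing) (V := C_NormedModule) (z ^ 2)%C) in H.
  revert H. apply is_series_ext. intros n.
  change (z ^ 2 * (RtoC (lommel_coef mu nu (S n)) * z ^ n)
          = RtoC (lommel_coef mu nu (S n)) * z ^ (S n + 1))%C.
  replace (S n + 1)%nat with (2 + n)%nat by lia. rewrite Cpow_add_r. ring.
Qed.

Theorem theorem3p1 (mu nu M N : R)
  (hplus : ~ neg_odd_integer (mu + nu))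
  (hminus : ~ neg_odd_integer (mu - nu))
  (hM : M = (mu + 5) ^ 2 - nu ^ 2)
  (hN : N = (mu + 3) ^ 2 - nu ^ 2)
  (hmu : mu > - 5 + sqrt (3 / 2 + nu ^ 2))
  (hMN : 4 * M / N < 2 * M - 3)
  (hmain :
     mu * (1 + 2 * sin 1)
       - 1 / 4 * exp 1 * (exp 1 - 1) * Rabs ((mu + 1) * (mu - 7) - nu ^ 2)
     >= exp 1 ^ 4 - 3 * exp 1 ^ 3 + 13 * exp 1 ^ 2 / 4 - 3 * exp 1 / 4
        - 3 / exp 1 + 2 - 2 * sin 1) :
  class_Ke (lommel_h mu nu).
Proof.
  destruct (lommel_parameter_bounds mu nu hmain) as [H3 H36].
  assert (Hc : forall n, Rabs (lommel_coef mu nu n) <= (1 / 36) ^ n)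
    by (intros n; now apply Rabs_lommel_coef_le).
  apply (class_Ke_CPSeries _ (PS_incr_1 (lommel_coef mu nu))).
  - intros z Hz. apply lommel_h_CPSeries.
    apply (Rbar_lt_trans (Cmod z) 1 _ Hz), (CV_radius_gt_1 _ 1 (1 / 36)); [lra|].
    intros n. rewrite Rmult_1_l. apply Hc.
  - reflexivity.
  - simpl. unfold lommel_coef; simpl. field.
  - exact Hc.
Qed.
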